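(* Let $0<\alpha<1$ and $p,q>0$. If $\mathrm{Tr}\,SG_{\alpha,p}(A,B)\le\mathrm{Tr}\,\mathcal{A}_{\alpha,q}(A,B)$ holds for all positive definite $2\times2$ matrices $A,B$, then $\min\{1,p/2\}\le q$.
   Context: For positive definite $A,B$: $A\#B:=A^{1/2}(A^{-1/2}BA^{-1/2})^{1/2}A^{1/2}$; $F_\alpha(A,B):=(A^{-1}\#B)^\alpha A(A^{-1}\#B)^\alpha$; $SG_{\alpha,p}(A,B):=F_\alpha(A^p,B^p)^{1/p}$; $\mathcal{A}_{\alpha,q}(A,B):=((1-\alpha)A^q+\alpha B^q)^{1/q}$. $\mathrm{Tr}$ is the usual trace. *)

(* Defs.v *)
(* mathcomp-analysis (powR on a realType R) +
   real_closed's complex numbers R[i] (a numClosedFieldType) +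
   mathcomp's spectral theorem (spectral.v). *)
From HB Require Import structures.
From mathcomp Require Import all_boot all_order all_algebra.
From mathcomp Require Import all_classical all_reals.
From mathcomp Require Import exp.
From mathcomp Require Import complex.

Set Implicit Arguments.
Unset Strict Implicit.
Unset Printing Implicit Defensive.

Import Order.TTheory GRing.Theory Num.Theory.
Local Open Scope ring_scope.
Local Open Scope sesquilinear_scope.
Local Open Scope complex_scope.

(* Positive definite n x n complex matrices: Hermitian (A^* = A) and
   v A v^* > 0 for every nonzero (row) vector v. *)
Definition posdefmx {R : realType} {n : nat} (A : 'M[R[i]]_n) : Prop :=
  A \is hermsymmx /\
  forall v : 'rV[R[i]]_n, v != 0 -> 0 < (v *m A *m (v ^t*)) 0 0.

(* Real power A^r of a positive definite matrix via its spectral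
   decomposition A = U^* diag(lambda) U (U unitary, from spectral.v):
   A^r := U^* diag(lambda^r) U, with lambda^r = powR (real part) r. *)
Definition mpow {R : realType} {n : nat} (A : 'M[R[i]]_n) (r : R) : 'M[R[i]]_n :=
  ((spectralmx A) ^t*) *m
    diag_mx (\row_j ((powR (complex.Re (spectral_diag A 0 j)) r)%:C)%C)
  *m spectralmx A.

(* Geometric mean  A # B := A^{1/2} (A^{-1/2} B A^{-1/2})^{1/2} A^{1/2}. *)
Definition gmean {R : realType} {n : nat} (A B : 'M[R[i]]_n) : 'M[R[i]]_n :=
  mpow A (2^-1) *m mpow (mpow A (- 2^-1) *m B *m mpow A (- 2^-1)) (2^-1)
    *m mpow A (2^-1).

(* F_alpha(A,B) := (A^{-1} # B)^alpha A (A^{-1} # B)^alpha. *)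
Definition Falpha {R : realType} {n : nat} (alpha : R) (A B : 'M[R[i]]_n) :
  'M[R[i]]_n :=
  mpow (gmean (invmx A) B) alpha *m A *m mpow (gmean (invmx A) B) alpha.

(* SG_{alpha,p}(A,B) := F_alpha(A^p, B^p)^{1/p}. *)
Definition SG {R : realType} {n : nat} (alpha p : R) (A B : 'M[R[i]]_n) :
  'M[R[i]]_n :=
  mpow (Falpha alpha (mpow A p) (mpow B p)) (p^-1).

(* A_{alpha,q}(A,B) := ((1-alpha) A^q + alpha B^q)^{1/q}. *)
Definition Aq {R : realType} {n : nat} (alpha q : R) (A B : 'M[R[i]]_n) :
  'M[R[i]]_n :=
  mpow (((1 - alpha)%:C)%C *: mpow A q + (alpha%:C)%C *: mpow B q) (q^-1).

(* Main.v *)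
Require Import Defs.
From HB Require Import structures.
From mathcomp Require Import all_boot all_order all_algebra.
From mathcomp Require Import all_classical all_reals.
From mathcomp Require Import exp.
From mathcomp Require Import complex.
From mathcomp Require Import sequences ring lra.
Import Order.TTheory GRing.Theory Num.Theory.
Local Open Scope ring_scope.

(* The witnesses are A = diag (1, a) and its conjugate B by the rotation of
   sine s, as a -> 0 and then s -> 0. The matrix X = A^-p # B^p is the unique
   positive X with X A^p X = B^p. It has determinant 1, and its eigenvectors are
   those of the reflection exchanging A and B, so F_alpha (A^p, B^p) =
   X^alpha A^p X^alpha is explicit: for small a its largest eigenvalue is
   1 - 2 alpha (1 - alpha) s^2 + O(s^3). Hence
     Tr SG >= 1 - 2 alpha (1 - alpha) s^2 / p + O(s^3),
   whereas the trace and the determinant of (1 - alpha) A^q + alpha B^q give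
     Tr A_q <= 1 - alpha (1 - alpha) s^2 / q + O(s^3) + O(s^(2/q)).
   If q < 1 then 2 / q > 2, and comparing the coefficients of s^2 gives
   p / 2 <= q. *)

(** * Real symmetric two-by-two matrices and their powers *)

Section SymmetricTwoByTwo.
Set Implicit Arguments.
Local Open Scope sesquilinear_scope.
Local Open Scope complex_scope.
Context {R : realType}.
Implicit Types (a b d x y r : R).

Definition symmx a b d : 'M[R[i]]_2 :=
  \matrix_(i, j) (if i == j then if i == 0 then a else d else b)%:C.

Lemma mx2P (T : Type) (A B : 'M[T]_2) :
  A 0 0 = B 0 0 -> A 0 1 = B 0 1 -> A 1 0 = B 1 0 -> A 1 1 = B 1 1 -> A = B.
Proof.
move=> h00 h01 h10 h11; apply/matrixP => i j.
have ord2 (k : 'I_2) : k = 0 \/ k = 1.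
  by case: k => [[|[|//]] hk]; [left|right]; apply: val_inj.
by case: (ord2 i) => ->; case: (ord2 j) => ->.
Qed.

Lemma symmx_affine a b d (u v : R) :
  u%:C *: symmx a b d + (v%:C)%:M = symmx (u * a + v) (u * b) (u * d + v).
Proof.
by apply: mx2P; rewrite !mxE /= ?mulr1n ?mulr0n ?addr0 ?rmorphD ?rmorphM.
Qed.

Lemma symmx_convex a b d a' b' d' (u v : R) :
  u%:C *: symmx a b d + v%:C *: symmx a' b' d' =
  symmx (u * a + v * a') (u * b + v * b') (u * d + v * d').
Proof. by apply: mx2P; rewrite !mxE /= rmorphD !rmorphM. Qed.

Lemma symmx_sandwich a b d a' b' d' :
  symmx a b d *m symmx a' b' d' *m symmx a b d =
  symmx (a ^+ 2 * a' + 2 * (a * b * b') + b ^+ 2 * d')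
        (a * b * a' + (a * d + b ^+ 2) * b' + b * d * d')
        (b ^+ 2 * a' + 2 * (b * d * b') + d ^+ 2 * d').
Proof.
apply: mx2P; rewrite !(mxE, big_ord_recl, big_ord0) /=;
  rewrite !(rmorphD, rmorphM, rmorphXn, rmorph_nat) /=; ring.
Qed.

Lemma tr_symmx a b d : \tr (symmx a b d) = (a + d)%:C.
Proof. by rewrite /mxtrace !(mxE, big_ord_recl, big_ord0) /= addr0 rmorphD. Qed.

Lemma det_symmx a b d : \det (symmx a b d) = (a * d - b ^+ 2)%:C.
Proof.
rewrite (expand_det_row _ 0) !big_ord_recl big_ord0 /cofactor !det_mx11 !mxE /=.
rewrite !(rmorphB, rmorphM, rmorphXn) /=; ring.
Qed.

Lemma symmx_herm a b d : symmx a b d \is hermsymmx.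
Proof.
apply/is_hermitianmxP; rewrite expr0 scale1r.
by apply: mx2P; rewrite !mxE /=; apply/esym/conjc_real.
Qed.

Lemma symmx_posdef a b d : 0 < a -> 0 < a * d - b ^+ 2 -> posdefmx (symmx a b d).
Proof.
move=> a0 D0; split; first exact: symmx_herm.
move=> v v0; rewrite -(pmulr_rgt0 _ (_ : 0 < a%:C)) ?ltcR//.
(* Completing the square: the determinant is the coefficient left on the second coordinate. *)
have -> : a%:C * (v *m symmx a b d *m v ^t*) 0 0 =
    (a%:C * v 0 0 + b%:C * v 0 1) * (a%:C * v 0 0 + b%:C * v 0 1)^* +
    (a * d - b ^+ 2)%:C * (v 0 1 * (v 0 1)^*).
  rewrite !(mxE, big_ord_recl, big_ord0) /=.
  have -> : lift ord0 ord0 = 1 :> 'I_2 by apply: val_inj.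
  have conjR (t : R) : Num.conj t%:C = t%:C := conjc_real t.
  rewrite !(rmorphD, rmorphM, rmorphN, rmorphXn) /= !conjR.
  by rewrite -[ord0]/(0 : 'I_2); ring.
have D0C : 0 < (a * d - b ^+ 2)%:C by rewrite ltcR.
have [v1|v1] := eqVneq (v 0 1) 0; last first.
  by rewrite ltr_wpDl ?mul_conjC_ge0 // mulr_gt0 // mul_conjC_gt0.
have v00 : v 0 0 != 0.
  apply: contraNneq v0 => v00; apply/eqP/rowP => j; rewrite mxE.
  case: j => [[|[|//]] hj]; [rewrite -[RHS]v00|rewrite -[RHS]v1];
    by congr (v _ _); apply: val_inj.
rewrite v1 mul0r !mulr0 !addr0 mul_conjC_gt0 mulf_neq0 //.
by rewrite gt_eqF // ltcR.
Qed.

(** Trace and determinant force the spectrum to be x, y. On it the r-th power agrees with an affine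
    function, so the same affine function of M gives [mpow M r]. No eigenvector of the abstract
    [spectralmx] has to be computed. *)
Lemma mpow_herm_affine (M : 'M[R[i]]_2) (x y u v r : R) : M \is hermsymmx ->
  \tr M = (x + y)%:C -> \det M = (x * y)%:C ->
  x `^ r = u * x + v -> y `^ r = u * y + v ->
  mpow M r = u%:C *: M + (v%:C)%:M.
Proof.
move=> /hermitian_normalmx /orthomx_spectralP ME trM detM hx hy.
have Uu := spectral_unit M.
set d := spectral_diag M in ME; set U := spectralmx M in ME Uu.
have trd : d 0 0 + d 0 1 = (x + y)%:C.
  rewrite -trM ME mxtrace_mulC mulmxA mulmxV // mul1mx mxtrace_diag.
  by rewrite !big_ord_recl big_ord0 addr0; congr (_ + d _ _); apply: val_inj.
have detd : d 0 0 * d 0 1 = (x * y)%:C.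
  rewrite -detM ME !det_mulmx det_inv mulrAC mulVr ?mul1r -?unitmxE //.
  rewrite det_diag !big_ord_recl big_ord0 mulr1.
  by congr (_ * d _ _); apply: val_inj.
(* Each eigenvalue is a root of the characteristic polynomial. The order in which [spectral_diag]
   lists them stays unknown, and is irrelevant here. *)
have dP j : d 0 j = x%:C \/ d 0 j = y%:C.
  have : (d 0 j - x%:C) * (d 0 j - y%:C) = 0.
    have -> : (d 0 j - x%:C) * (d 0 j - y%:C) =
        d 0 j ^+ 2 - d 0 j * (x + y)%:C + (x * y)%:C.
      by rewrite rmorphD rmorphM /=; ring.
    rewrite -trd -detd; have [->|->] : j = 0 \/ j = 1; try ring.
    by case: j => [[|[|//]] hj]; [left|right]; apply: val_inj.
  move=> /eqP; rewrite mulf_eq0 !subr_eq0.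
  by case/orP => /eqP ->; [left|right].
rewrite /mpow -/d -/U [in RHS]ME invmx_unitary ?spectral_unitarymx //.
rewrite -/U.
have -> : \row_j (complex.Re (d 0 j) `^ r)%:C = u%:C *: d + const_mx v%:C.
  apply/rowP => j; rewrite !mxE.
  by case: (dP j) => -> /=; rewrite ?hx ?hy rmorphD rmorphM.
rewrite linearD linearZ /= diag_const_mx mulmxDr mulmxDl -scalemxAr -scalemxAl.
congr (_ + _).
rewrite scalar_mxC -mulmxA -invmx_unitary ?spectral_unitarymx // -/U.
by rewrite mulVmx // mulmx1.
Qed.

Lemma mpow_symmx a b d x y u v r :
  x + y = a + d -> x * y = a * d - b ^+ 2 ->
  x `^ r = u * x + v -> y `^ r = u * y + v ->
  mpow (symmx a b d) r = symmx (u * a + v) (u * b) (u * d + v).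
Proof.
move=> s p hx hy; rewrite -symmx_affine.
apply: (@mpow_herm_affine _ x y _ _ _ (symmx_herm a b d)) => //.
  by rewrite tr_symmx s.
by rewrite det_symmx p.
Qed.

Lemma powR_interpolation x y r :
  exists u v, x `^ r = u * x + v /\ y `^ r = u * y + v.
Proof.
have [<-|/eqP xy] := eqVneq x y.
  by exists 0, (x `^ r); rewrite mul0r add0r.
exists ((x `^ r - y `^ r) / (x - y)), (x `^ r - (x `^ r - y `^ r) / (x - y) * x).
by split; field; rewrite subr_eq0; apply/eqP.
Qed.

Lemma tr_mpow_symmx a b d x y r :
  x + y = a + d -> x * y = a * d - b ^+ 2 ->
  \tr (mpow (symmx a b d) r) = (x `^ r + y `^ r)%:C.
Proof.
move=> s p; have [u [v [hx hy]]] := powR_interpolation x y r.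
rewrite (@mpow_symmx _ _ _ _ _ _ _ _ s p hx hy) tr_symmx hx hy; congr (_ %:C).
by rewrite addrACA -mulrDr -s; ring.
Qed.

End SymmetricTwoByTwo.

(** * Matrices given by their spectral data, and the geometric mean *)

Section GeometricMean.
Set Implicit Arguments.
Local Open Scope complex_scope.
Context {R : realType}.
Implicit Types (a b d x y r : R).

(** Produces the eigenvalues that [mpow_symmx] and [tr_mpow_symmx] expect from a trace and a
    determinant. *)
Lemma pos_roots_sum_prod (t d : R) : 0 < t -> 0 < d -> 4 * d <= t ^+ 2 ->
  exists x y : R, [/\ x + y = t, x * y = d, 0 < y & y <= x].
Proof.
move=> t0 d0 disc; set q := Num.sqrt (t ^+ 2 - 4 * d).
have q0 : 0 <= q by exact: sqrtr_ge0.
have q2 : q ^+ 2 = t ^+ 2 - 4 * d by rewrite sqr_sqrtr // subr_ge0.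
have qt : q < t by rewrite ltNge; apply/negP => tq; nra.
exists ((t + q) / 2), ((t - q) / 2); split; [by field| |by lra|by lra].
transitivity ((t ^+ 2 - q ^+ 2) / 4); first by field.
by rewrite q2; field.
Qed.

(* x P + y (1 - P) for the orthogonal projection P of first diagonal entry c
   and off-diagonal entry o, which requires o ^ 2 = c (1 - c). *)
Definition specmx (c o x y : R) : 'M[R[i]]_2 :=
  symmx (x * c + y * (1 - c)) ((x - y) * o) (x * (1 - c) + y * c).

Lemma mpow_specmx c o x y r : o ^+ 2 = c * (1 - c) ->
  mpow (specmx c o x y) r = specmx c o (x `^ r) (y `^ r).
Proof.
move=> ho; have [u [v [hx hy]]] := powR_interpolation x y r.
have s : x + y = x * c + y * (1 - c) + (x * (1 - c) + y * c) by ring.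
have p : x * y =
    (x * c + y * (1 - c)) * (x * (1 - c) + y * c) - ((x - y) * o) ^+ 2.
  by rewrite exprMn ho; ring.
rewrite /specmx (@mpow_symmx _ _ _ _ _ _ _ _ _ s p hx hy) hx hy.
by congr symmx; ring.
Qed.

Lemma specmx_posdef c o x y : o ^+ 2 = c * (1 - c) -> 0 <= c <= 1 ->
  0 < x -> 0 < y -> posdefmx (specmx c o x y).
Proof.
move=> ho /andP[c0 c1] x0 y0; apply: symmx_posdef.
  have [->|cn0] := eqVneq c 0; first by rewrite mulr0 add0r subr0 mulr1.
  have cp : 0 < c by rewrite lt_def cn0.
  by rewrite ltr_pwDl ?mulr_gt0 // mulr_ge0 ?subr_ge0 // ltW.
rewrite exprMn ho.
have -> : (x * c + y * (1 - c)) * (x * (1 - c) + y * c) -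
  (x - y) ^+ 2 * (c * (1 - c)) = x * y by ring.
exact: mulr_gt0.
Qed.

Lemma diag_offdiag_sq : 0 ^+ 2 = 1 * (1 - 1) :> R. Proof. by ring. Qed.

Lemma invmx_specmx10 x : x != 0 -> invmx (specmx 1 0 1 x) = specmx 1 0 1 x^-1.
Proof.
move=> x0; have mul1 : specmx 1 0 1 x *m specmx 1 0 1 x^-1 = 1%:M.
  have xC : x%:C != 0 by rewrite -[0]/(0%:C) (inj_eq (@complexI _)).
  apply: mx2P; rewrite !(mxE, big_ord_recl, big_ord0) /=
    !(rmorphM, rmorphD, rmorphN, rmorph0, rmorph1, fmorphV) /=; field; exact: xC.
have [Ux _] := mulmx1_unit mul1.
by rewrite -[RHS](mulKmx Ux) mul1 mulmx1.
Qed.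

(* By Cayley-Hamilton, the positive square root G of H = G ^ 2 is
   (H + det G) / tr G; here G = A^(1/2) X A^(1/2) and B = X A X. *)
Lemma gmean_symmx (t x11 x12 x22 : R) : 0 < t -> 0 < x11 -> 0 < x22 ->
  x11 * x22 - x12 ^+ 2 = 1 ->
  gmean (invmx (specmx 1 0 1 t))
    (symmx x11 x12 x22 *m specmx 1 0 1 t *m symmx x11 x12 x22) =
  symmx x11 x12 x22.
Proof.
move=> t0 x11p x22p detx; set e : R := Num.sqrt t.
have e0 : 0 < e by rewrite sqrtr_gt0.
have e2 : t = e ^+ 2 by rewrite sqr_sqrtr // ltW.
have eV : t^-1 `^ 2^-1 = e^-1.
  by rewrite powR12_sqrt ?invr_ge0 ?ltW // sqrtrV // ltW.
have eVN : t^-1 `^ (- 2^-1) = e by rewrite powRN eV invrK.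
rewrite invmx_specmx10 ?gt_eqF // /gmean !(mpow_specmx _ _ _ _ _ diag_offdiag_sq)
  !powR1 eV eVN.
have g0 : 0 < x11 + t * x22 by rewrite addr_gt0 // mulr_gt0.
(* x and y are the eigenvalues of G, whose determinant is t because X has determinant 1. The matrix
   H then has eigenvalues x^2 and y^2. *)
have [|x [y [s p y0 yx]]] := pos_roots_sum_prod _ _ g0 t0.
  rewrite -subr_ge0.
  have -> : (x11 + t * x22) ^+ 2 - 4 * t =
     (x11 - t * x22) ^+ 2 + 4 * t * x12 ^+ 2 + 4 * t * (x11 * x22 - x12 ^+ 2 - 1) by ring.
  have t4 : 0 <= 4 * t by rewrite mulr_ge0 // ltW.
  by rewrite detx subrr mulr0 addr0 addr_ge0 ?sqr_ge0 // mulr_ge0 ?sqr_ge0.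
have x0 : 0 < x by apply: lt_le_trans yx.
have sq (z : R) : 0 <= z -> (z ^+ 2) `^ 2^-1 = z.
  by move=> z0; rewrite powR12_sqrt ?sqr_ge0 // sqrtr_sqr ger0_norm.
have xy0 : x + y != 0 by rewrite gt_eqF // addr_gt0.
(* The secant of the square root through x^2 and y^2, written so that it stays valid when x = y. *)
have hx : (x ^+ 2) `^ 2^-1 = (x + y)^-1 * x ^+ 2 + x * y / (x + y).
  by rewrite sq ?ltW //; field.
have hy : (y ^+ 2) `^ 2^-1 = (x + y)^-1 * y ^+ 2 + x * y / (x + y).
  by rewrite sq ?ltW //; field.
(* Eliminating x22 builds the determinant condition into the identities left to [field]. *)
have x22E : x22 = (1 + x12 ^+ 2) / x11.
  by apply: (canRL (mulfK _)); rewrite ?gt_eqF // -detx; ring.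
have x11n0 : x11 != 0 by rewrite gt_eqF.
have en0 : e != 0 by rewrite gt_eqF.
have den0 : x11 * x11 + e ^+ 2 * (1 + x12 ^+ 2) != 0.
  by rewrite gt_eqF // ltr_pwDl ?mulr_gt0 // mulr_ge0 ?addr_ge0 ?sqr_ge0.
rewrite /specmx !symmx_sandwich.
rewrite (@mpow_symmx _ _ _ _ (x ^+ 2) (y ^+ 2) _ _ _ _ _ hx hy).
- rewrite symmx_sandwich p s e2 x22E; congr symmx; field; exact/and3P.
- have -> : x ^+ 2 + y ^+ 2 = (x + y) ^+ 2 - 2 * (x * y) by ring.
  by rewrite s p e2 x22E; field.
- have -> : x ^+ 2 * y ^+ 2 = (x * y) ^+ 2 by ring.
  by rewrite p e2 x22E; field.
Qed.

(** * The family of witnesses and its two traces *)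

Section Family.
Variables (alpha p q a s c m : R).
Hypothesis (a0 : 0 < a).
Hypotheses (s1 : s < 1) (sc1 : c ^+ 2 = 1 - s ^+ 2) (s0 : 0 <= s) (m0 : 0 < m).

Let A := specmx 1 0 1 a.
Let B := specmx (1 - s ^+ 2) (c * s) 1 a.
Let e := a `^ p.
Let w := m `^ alpha.

Lemma rotation_offdiag_sq :
  (c * s) ^+ 2 = (1 - s ^+ 2) * (1 - (1 - s ^+ 2)).
Proof. by rewrite exprMn sc1; ring. Qed.

Lemma reflection_offdiag_sq :
  (c / 2) ^+ 2 = (1 - s) / 2 * (1 - (1 - s) / 2).
Proof. by rewrite exprMn sc1; field. Qed.

(* m and 1 / m are the eigenvalues of X = A^(-p) # B^p: the first hypothesis
   amounts to X A^p X = B^p. *)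
Lemma tr_SG f1 f2 :
  (1 - e) * s * (m ^+ 2 + 1) = (1 + e) * (m ^+ 2 - 1) ->
  f1 + f2 =
    (1 + e) * (w ^+ 2 + w ^- 2) / 2 - (1 - e) * s * (w ^+ 2 - w ^- 2) / 2 ->
  f1 * f2 = e ->
  \tr (SG alpha p A B) = (f1 `^ p^-1 + f2 `^ p^-1)%:C.
Proof.
move=> hs hf1 hf2.
have e0 : 0 < e by apply: powR_gt0.
have mn0 : m != 0 by rewrite gt_eqF.
have w0 : 0 < w by apply: powR_gt0.
have wn0 : w != 0 by rewrite gt_eqF.
(* With s = sin theta and c = cos theta, the m-eigenvector lies at angle pi/4 + theta/2, whose
   squared cosine is (1 - s)/2. Reflection in it exchanges e A^(-p) and B^p, which have their
   eigenvalue 1 at angles pi/2 and theta. *)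
pose X := specmx ((1 - s) / 2) (c / 2) m m^-1.
have BE : specmx (1 - s ^+ 2) (c * s) 1 e = X *m specmx 1 0 1 e *m X.
  rewrite /X /specmx symmx_sandwich.
  (* h is the defect in the equation [hs]; every entry of B^p - X A^p X is a multiple of it. *)
  set h := m ^+ 2 * ((1 - s) + e * (1 + s)) - ((1 + s) + e * (1 - s)).
  have h0 : h = 0.
    transitivity ((1 + e) * (m ^+ 2 - 1) - (1 - e) * s * (m ^+ 2 + 1)).
      by rewrite /h; ring.
    by rewrite hs subrr.
  congr symmx; apply: subr0_eq.
  - transitivity (- h * (((1 - s) * m ^+ 2 - (1 + s)) / (4 * m ^+ 2))).
      by rewrite /h; field: sc1.
    by rewrite h0 oppr0 mul0r.
  - transitivity (- h * (c * (m ^+ 2 + 1) / (4 * m ^+ 2))).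
      by rewrite /h; field: sc1.
    by rewrite h0 oppr0 mul0r.
  - transitivity (- h * (((1 + s) * m ^+ 2 - (1 - s)) / (4 * m ^+ 2))).
      by rewrite /h; field: sc1.
    by rewrite h0 oppr0 mul0r.
rewrite /SG /A /B !(mpow_specmx _ _ _ _ _ diag_offdiag_sq)
  !(mpow_specmx _ _ _ _ _ rotation_offdiag_sq) !powR1 -/e BE.
have V0 : 0 < m^-1 by rewrite invr_gt0.
have c1 : 0 < (1 - s) / 2 by rewrite divr_gt0 // subr_gt0.
have c2 : 0 < 1 - (1 - s) / 2.
  by rewrite (_ : _ - _ = (1 + s) / 2); [rewrite divr_gt0 // ltr_pwDl|field].
have gE : gmean (invmx (specmx 1 0 1 e)) (X *m specmx 1 0 1 e *m X) = X.
  apply: gmean_symmx => //.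
  - by apply: addr_gt0; apply: mulr_gt0.
  - by apply: addr_gt0; apply: mulr_gt0.
  - by rewrite exprMn reflection_offdiag_sq; field.
have wV : m^-1 `^ alpha = w^-1.
  by rewrite -powR_inv1 ?ltW // -powRrM mulrC powRrM powR_inv1 // ltW.
rewrite /Falpha gE (mpow_specmx _ _ _ _ _ reflection_offdiag_sq) wV
  -/w /specmx symmx_sandwich.
apply: tr_mpow_symmx; rewrite ?hf1 ?hf2; field: sc1; exact: wn0.
Qed.

(** The determinant is a quadratic form on two-by-two matrices, so at the convex combination it
    equals the common determinant a^q minus alpha (1 - alpha) det (A^q - B^q), and det (A^q - B^q) =
    - (1 - a^q)^2 s^2. *)
Lemma tr_Aq n1 n2 :
  n1 + n2 = 1 + a `^ q ->
  n1 * n2 = a `^ q + alpha * (1 - alpha) * (1 - a `^ q) ^+ 2 * s ^+ 2 ->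
  \tr (Aq alpha q A B) = (n1 `^ q^-1 + n2 `^ q^-1)%:C.
Proof.
move=> hn1 hn2.
rewrite /Aq /A /B !(mpow_specmx _ _ _ _ _ diag_offdiag_sq)
  !(mpow_specmx _ _ _ _ _ rotation_offdiag_sq) !powR1.
rewrite symmx_convex; apply: tr_mpow_symmx; rewrite ?hn1 ?hn2; first by ring.
rewrite mulr0 mulr0 add0r !exprMn sc1; ring.
Qed.
End Family.

End GeometricMean.

(** * Scalar estimates *)

Section Estimates.
Context {R : realType}.

Lemma expR_ge1Dx2 (x : R) : 0 <= x -> 1 + x + x ^+ 2 / 2 <= expR x.
Proof.
move=> x0; have -> : 1 + x + x ^+ 2 / 2 = series (exp_coeff x) 3.
  rewrite /series /= !big_nat_recr // big_nil /exp_coeff /=.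
  by rewrite !factS fact0 add0r expr0 expr1 !divr1.
apply: nondecreasing_cvgn_le; last exact: is_cvg_series_exp_coeff.
by apply: nondecreasing_series => n _ _; exact: exp_coeff_ge0.
Qed.

(** Follows from 2 cosh x = 2 + (2 sinh (x/2))^2 and sinh y >= y for y >= 0. *)
Lemma expR_add_expRN_ge (x : R) : 2 + x ^+ 2 <= expR x + expR (- x).
Proof.
wlog x0 : x / 0 <= x.
  move=> H; have [/H //|/ltW x0] := leP 0 x.
  by have := H (- x); rewrite oppr_ge0 sqrrN opprK addrC => /(_ x0); lra.
set y := x / 2; have y0 : 0 <= y by rewrite divr_ge0.
have E2 : expR y ^+ 2 = expR x by rewrite -expRM_natr /y; congr expR; field.
have := expR_ge1Dx2 _ y0; set E := expR y in E2 * => E1.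
have Ep : 0 < E := expR_gt0 y.
have h : 2 * y <= E - E^-1.
  have -> : E - E^-1 = (E ^+ 2 - 1) / E by field; rewrite gt_eqF.
  rewrite ler_pdivlMr //.
  (* The goal E^2 - 1 >= 2 y E reads (E - y)^2 >= 1 + y^2, and E - y >= 1 + y^2/2. *)
  have : (1 + y + y ^+ 2 / 2 - y) ^+ 2 <= (E - y) ^+ 2.
    by rewrite ler_sqr ?nnegrE; nra.
  have := exprn_ge0 4 y0; rewrite !exprS expr0; nra.
have : (2 * y) ^+ 2 <= (E - E^-1) ^+ 2 by rewrite ler_sqr ?nnegrE; nra.
have -> : (E - E^-1) ^+ 2 = E ^+ 2 + E ^- 2 - 2 by field; rewrite gt_eqF.
have -> : 2 * y = x by rewrite /y; field.
by rewrite expRN -E2; lra.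
Qed.

(* With k = tanh t one has m = e^t, and the larger side is
   cosh ((2 alpha - 1) t) / cosh t. *)
Lemma cosh_ratio_ge (alpha k : R) (m := Num.sqrt ((1 + k) / (1 - k)))
    (w := m `^ alpha) :
  0 < alpha -> alpha < 1 -> 0 < k -> k <= 4^-1 ->
  1 - 2 * (alpha * (1 - alpha)) * k ^+ 2 - 2 * k ^+ 3 <=
  ((w ^+ 2 + w ^- 2) - k * (w ^+ 2 - w ^- 2)) / 2.
Proof.
move=> al0 al1 k0 k1.
have k1' : 0 < 1 - k by lra.
have kp : 0 < 1 + k by lra.
have m2 : m ^+ 2 = (1 + k) / (1 - k) by rewrite sqr_sqrtr // divr_ge0 // ltW.
have m0 : 0 < m by rewrite sqrtr_gt0 divr_gt0.
(* A crude bound for artanh k, from ln (1 + z) <= z applied to m^(-2) = 1 - 2k/(1 + k). *)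
have lnm : k - k ^+ 2 <= ln m.
  have : ln (m ^- 2) <= - (2 * k / (1 + k)).
    have -> : m ^- 2 = 1 + - (2 * k / (1 + k)).
      by rewrite m2; field; rewrite !gt_eqF.
    apply: le_ln1Dx; rewrite ltrN2 ltr_pdivrMr //; lra.
  rewrite lnV ?posrE ?exprn_gt0 // lnXn // => h.
  have h2 : k - k ^+ 2 <= k / (1 + k).
    rewrite ler_pdivlMr //; have := exprn_gt0 3 k0; rewrite !exprS expr0; nra.
  have h3 : 2 * k / (1 + k) = 2 * (k / (1 + k)) by rewrite mulrA.
  rewrite h3 mulr2n in h; lra.
set b := 2 * alpha - 1; set v := m `^ b.
have v0 : 0 < v by apply: powR_gt0.
have vge : 2 + b ^+ 2 * (k - k ^+ 2) ^+ 2 <= v + v^-1.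
  have -> : v = expR (b * ln m) by rewrite /v /powR gt_eqF.
  rewrite -expRN; apply: le_trans (expR_add_expRN_ge _).
  rewrite lerD2l exprMn ler_wpM2l ?sqr_ge0 //.
  rewrite ler_sqr ?nnegrE //; nra.
have w2 : w ^+ 2 = m * v.
  rewrite /w /v -powR_mulrn ?powR_ge0 // -powRrM.
  have -> : alpha * 2 = 1 + b by rewrite /b; ring.
  by rewrite powRD ?powRr1 ?ltW // (gt_eqF m0) implybT.
(* r is 1 / cosh t, and (v + 1/v)/2 is cosh (b t). *)
set r := 2 * m / (m ^+ 2 + 1).
have kne : 1 - k != 0 by rewrite gt_eqF.
have m1 : m ^+ 2 + 1 = 2 / (1 - k) by rewrite m2; field.
have r2 : r ^+ 2 = 1 - k ^+ 2.
  by rewrite /r m1 expr_div_n exprMn m2; field.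
have phiE : ((w ^+ 2 + w ^- 2) - k * (w ^+ 2 - w ^- 2)) / 2 = r * ((v + v^-1) / 2).
  have -> : k = (m ^+ 2 - 1) / (m ^+ 2 + 1) by rewrite m1 m2; field.
  rewrite w2 /r; field.
  by rewrite !(gt_eqF, m0, v0) //= addr_gt0 // exprn_gt0.
rewrite phiE.
have r0 : 0 < r by rewrite /r m1 !(mulr_gt0, divr_gt0, invr_gt0).
(* The bound sqrt (1 - z) >= 1 - z/2 - z^2/2 on [0, 1], at z = k^2. *)
have rge : 1 - k ^+ 2 / 2 - k ^+ 4 / 2 <= r.
  have k40 := exprn_ge0 4 (ltW k0).
  have k20 : 0 <= k ^+ 2 <= 1 by apply/andP; split; nra.
  have k42 : k ^+ 4 = k ^+ 2 ^+ 2 by rewrite -exprM.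
  rewrite k42; set z := k ^+ 2 in k20 r2 *; move: k20 => /andP[z0 z1].
  have : (1 - z / 2 - z ^+ 2 / 2) ^+ 2 <= r ^+ 2.
    rewrite r2 -subr_ge0.
    have -> : 1 - z - (1 - z / 2 - z ^+ 2 / 2) ^+ 2 = z ^+ 2 * ((1 - z) * (3 + z)) / 4.
      by field.
    by rewrite divr_ge0 // mulr_ge0 ?sqr_ge0 // mulr_ge0 ?subr_ge0 // addr_ge0.
  rewrite ler_sqr ?nnegrE ?(ltW r0) //; nra.
have b2 : b ^+ 2 = 1 - 4 * (alpha * (1 - alpha)) by rewrite /b; ring.
have ab : 0 <= alpha * (1 - alpha) by rewrite mulr_ge0 // ltW // subr_gt0.
have b21 : b ^+ 2 <= 1 by rewrite b2; lra.
set y := b ^+ 2 * (k - k ^+ 2) ^+ 2 / 2.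
have y1 : b ^+ 2 * (k ^+ 2 - 2 * k ^+ 3) / 2 <= y.
  apply: ler_wpM2r; first by rewrite invr_ge0.
  apply: ler_wpM2l; first exact: sqr_ge0.
  have -> : (k - k ^+ 2) ^+ 2 = k ^+ 2 - 2 * k ^+ 3 + k ^+ 4 by ring.
  by rewrite lerDl exprn_ge0 // ltW.
have y2 : 1 + y <= (v + v^-1) / 2 by rewrite /y; lra.
have y0 : 0 <= y by rewrite /y divr_ge0 // mulr_ge0 ?sqr_ge0.
have k2 : 0 <= k ^+ 2 / 2 + k ^+ 4 / 2.
  by rewrite addr_ge0 // divr_ge0 // exprn_ge0 // ltW.
have y3 : y <= k ^+ 2 / 2.
  apply: ler_wpM2r; first by rewrite invr_ge0.
  rewrite -[leRHS]mul1r; apply: ler_pM; rewrite ?sqr_ge0 //.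
  by rewrite ler_sqr ?nnegrE; nra.
(* In the product of the two lower bounds the coefficient of k^2 is (b^2 - 1)/2 = - 2 alpha (1 -
   alpha). The cross terms are at most k^4, hence absorbed in the cubic error. *)
apply: (@le_trans _ _ ((1 - k ^+ 2 / 2 - k ^+ 4 / 2) * (1 + y))).
  have yk : y * (k ^+ 2 / 2 + k ^+ 4 / 2) <= k ^+ 4.
    have k42 : k ^+ 4 = k ^+ 2 ^+ 2 by rewrite -exprM.
    have : y * (k ^+ 2 / 2 + k ^+ 4 / 2) <= k ^+ 2 / 2 * (k ^+ 2 / 2 + k ^+ 4 / 2).
      by rewrite ler_wpM2r.
    have : k ^+ 2 <= 1 by nra.
    have := sqr_ge0 k; rewrite k42; set z := k ^+ 2; nra.
  have k43 : k ^+ 4 <= k ^+ 3 / 4.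
    by rewrite exprSr ler_wpM2l // exprn_ge0 // ltW.
  have bk : b ^+ 2 * k ^+ 3 <= k ^+ 3.
    by rewrite -[leRHS]mul1r ler_wpM2r ?exprn_ge0 ?(ltW k0).
  have k30 := exprn_ge0 3 (ltW k0).
  rewrite b2 in y1 bk; lra.
apply: ler_pM => //; last exact: addr_ge0.
have k42 : k ^+ 4 = k ^+ 2 ^+ 2 by rewrite -exprM.
have : k ^+ 2 <= 1 by nra.
have := sqr_ge0 k; rewrite k42; set z := k ^+ 2; nra.
Qed.

(** Uses exp z >= 1 + z and - ln (1 - x) <= x/(1 - x) <= x + 2 x^2, the last step needing x <=
    1/2. *)
Lemma powR_1B_ge (x r : R) : 0 <= r -> 0 <= x -> x <= 2^-1 ->
  1 - r * (x + 2 * x ^+ 2) <= (1 - x) `^ r.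
Proof.
move=> r0 x0 x1; have xp : 0 < 1 - x by lra.
rewrite /powR gt_eqF //; apply: le_trans (expR_ge1Dx _).
rewrite lerD2l -mulrN ler_wpM2l // lerNl -lnV ?posrE //.
have -> : (1 - x)^-1 = 1 + x / (1 - x) by field; rewrite gt_eqF.
apply: (@le_trans _ _ (x / (1 - x))).
  apply: le_ln1Dx; apply: lt_le_trans (divr_ge0 x0 (ltW xp)); lra.
by rewrite ler_pdivrMr //; nra.
Qed.

(** With z = r y, the chain is (1 - y)^r <= exp (- z) <= 1/(1 + z) <= 1 - z + z^2. *)
Lemma powR_1B_le (y r : R) : 0 <= r -> 0 <= y -> y < 1 ->
  (1 - y) `^ r <= 1 - r * y + r ^+ 2 * y ^+ 2.
Proof.
move=> r0 y0 y1; have yp : 0 < 1 - y by lra.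
have ry : 0 <= r * y by rewrite mulr_ge0.
apply: (@le_trans _ _ (expR (- (r * y)))).
  rewrite /powR gt_eqF // ler_expR -mulrN ler_wpM2l //.
  by apply: le_ln1Dx; lra.
apply: (@le_trans _ _ (1 + r * y)^-1).
  by rewrite expRN lef_pV2 ?posrE ?expR_gt0 ?expR_ge1Dx // ltr_pwDl.
rewrite -exprMn; set z := r * y in ry *.
rewrite -[X in X <= _]mul1r ler_pdivrMr; last by rewrite ltr_pwDl.
have := exprn_ge0 3 ry; rewrite !exprS expr0; nra.
Qed.

(** The larger root is at least t/2 >= 1/4, so the smaller one, e/x, is at most 4e. *)
Lemma dominant_root_ge (t e x y : R) : 2^-1 <= t -> x + y = t -> x * y = e ->
  0 < y -> y <= x -> t - 4 * e <= x.
Proof.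
move=> t2 s <- y0 yx; have x1 : 0 <= 4 * x - 1 by lra.
have := mulr_ge0 (ltW y0) x1; rewrite -s; lra.
Qed.

(** Sum and product give (1 - x)(1 - y) = g with 0 < 1 - y < 1, which bounds x; and y = (d + g)/x
    with x >= 1/2. *)
Lemma root_bounds (d g x y : R) : 0 < d -> d < 1 -> 0 <= g ->
  x + y = 1 + d -> x * y = d + g -> 0 < y -> y <= x ->
  x <= 1 - g /\ y <= 2 * (d + g).
Proof.
move=> d0 d1 g0 s p y0 yx.
have E : (1 - x) * (1 - y) = g by rewrite mulrBl mul1r mulrBr mulr1 p; lra.
split; nra.
Qed.

(** Meant for rho = 1/p and r = 1/q. The k^2 coefficients of the two sides are - r beta and - 2 rho
    beta, and r > 1 makes (4 k^2)^r negligible against k^2. *)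
Lemma power_gap (beta rho r : R) : 0 < beta -> beta <= 4^-1 -> 0 < rho ->
  1 < r -> 2 * rho < r ->
  exists k, [/\ 0 < k, k <= 4^-1, k <= beta &
    (1 - (beta * k ^+ 2 - k ^+ 3)) `^ r + (4 * k ^+ 2) `^ r <
    (1 - (2 * beta * k ^+ 2 + 3 * k ^+ 3)) `^ rho].
Proof.
move=> b0 b1 rho0 r1 rr.
have r0 : 0 < r by lra.
(* D is the gap between the k^2 coefficients and C bounds the cubic errors. K makes (4 k^2)^r cost
   at most half of D k^2, and k <= D/(4C) makes the cubic terms cost at most a quarter. *)
set D := beta * (r - 2 * rho).
have D0 : 0 < D by rewrite mulr_gt0 // subr_gt0.
set C := 5 * rho + r + r ^+ 2.
have C0 : 0 < C by rewrite addr_gt0 ?exprn_gt0 // addr_gt0 // mulr_gt0.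
set K := (D / 8) `^ (r - 1)^-1.
have K0 : 0 < K by rewrite powR_gt0 // divr_gt0.
pose k := Num.min (Num.min 4^-1 beta) (Num.min (D / (4 * C)) K).
have k0 : 0 < k.
  by rewrite !lt_min b0 K0 invr_gt0 ltr0n (divr_gt0 D0) // mulr_gt0.
have k1 : k <= 4^-1 by rewrite !ge_min lexx.
have k2 : k <= beta by rewrite !ge_min lexx orbT.
have k3 : C * k <= D / 4.
  rewrite mulrC -ler_pdivlMr // -mulrA -invfM.
  by rewrite !ge_min lexx !orbT.
have k4 : k <= K by rewrite !ge_min lexx !orbT.
clearbody k; exists k; split => //.
have z0 : 0 < k ^+ 2 by rewrite exprn_gt0.
have z1 : k ^+ 2 <= 4^-1 * k by rewrite expr2 ler_wpM2r // ltW.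
have hpow : (4 * k ^+ 2) `^ r <= D / 2 * k ^+ 2.
  have p4 : 0 <= 4 * k ^+ 2 by rewrite mulr_ge0 // ltW.
  rewrite -mulr_powRB1 //.
  have : (4 * k ^+ 2) `^ (r - 1) <= D / 8.
    apply: (@le_trans _ _ (K `^ (r - 1))).
      apply: ge0_ler_powR; rewrite ?nnegrE ?subr_ge0 ?(ltW r1) ?(ltW K0) //; lra.
    rewrite /K -powRrM mulVf ?powRr1 //; first by rewrite divr_ge0 // ltW.
    by rewrite gt_eqF // subr_gt0.
  by move=> /(ler_wpM2l p4); lra.
set x := 2 * beta * k ^+ 2 + 3 * k ^+ 3.
set y := beta * k ^+ 2 - k ^+ 3.
have k30 : 0 < k ^+ 3 by rewrite exprn_gt0.
have k31 : k ^+ 3 <= 4^-1 * k ^+ 2 by rewrite exprS ler_wpM2r // ltW.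
have bz : beta * k ^+ 2 <= 4^-1 * k ^+ 2 by rewrite ler_wpM2r // ltW.
have bz0 : 0 < beta * k ^+ 2 by rewrite mulr_gt0.
have x0 : 0 <= x by rewrite /x; lra.
have x1 : x <= 2 * k ^+ 2 by rewrite /x; lra.
have y0 : 0 <= y by rewrite subr_ge0 exprS ler_wpM2r // ltW.
have y1 : y <= k ^+ 2 by rewrite /y; lra.
have lo := powR_1B_ge x rho (ltW rho0) x0 _.
have hi := powR_1B_le y r (ltW r0) y0 _.
have x2 : 2 * x ^+ 2 <= 2 * k ^+ 3.
  have -> : k ^+ 3 = k * k ^+ 2 by rewrite exprS.
  have : x ^+ 2 <= (2 * k ^+ 2) * (2 * k ^+ 2) by rewrite expr2 ler_pM.
  have : k ^+ 2 * k ^+ 2 <= 4^-1 * k * k ^+ 2 by rewrite ler_wpM2r // ltW.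
  lra.
have y2 : r ^+ 2 * y ^+ 2 <= r ^+ 2 * k ^+ 3.
  apply: ler_wpM2l; first exact: sqr_ge0.
  have -> : k ^+ 3 = k * k ^+ 2 by rewrite exprS.
  have : y ^+ 2 <= k ^+ 2 * k ^+ 2 by rewrite expr2 ler_pM.
  have : k ^+ 2 * k ^+ 2 <= 4^-1 * k * k ^+ 2 by rewrite ler_wpM2r // ltW.
  have : 0 <= k * k ^+ 2 by rewrite mulr_ge0 // ltW.
  lra.
have x3 : rho * (x + 2 * x ^+ 2) <= rho * (2 * beta * k ^+ 2 + 5 * k ^+ 3).
  by rewrite ler_wpM2l ?(ltW rho0) //; rewrite /x in x2 *; lra.
have Ck : C * k ^+ 3 <= D / 4 * k ^+ 2.
  by rewrite exprS mulrA ler_wpM2r // ltW.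
have Dz : 0 < D * k ^+ 2 by rewrite mulr_gt0.
apply: le_lt_trans (lerD (hi _) hpow) _; first by lra.
apply: lt_le_trans (lo _); last by lra.
rewrite /C in Ck; rewrite /D in Ck Dz *; rewrite /y in y2 *; lra.
Qed.

End Estimates.

(** * Choice of the parameters and contradiction *)

Lemma powR_le_both (R : realType) (p q t : R) : 0 < p -> 0 < q -> 0 < t ->
  exists a, [/\ 0 < a, a `^ p <= t & a `^ q <= t].
Proof.
move=> p0 q0 t0; exists (Num.min (t `^ p^-1) (t `^ q^-1)).
have m0 : 0 < Num.min (t `^ p^-1) (t `^ q^-1) by rewrite lt_min !powR_gt0.
have root r : 0 < r -> Num.min (t `^ p^-1) (t `^ q^-1) <= t `^ r^-1 ->
    Num.min (t `^ p^-1) (t `^ q^-1) `^ r <= t.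
  move=> r0 h; apply: le_trans (ge0_ler_powR (ltW r0) _ _ h) _.
  - by rewrite nnegrE ltW.
  - by rewrite nnegrE powR_ge0.
  - by rewrite -powRrM mulVf ?gt_eqF // powRr1 // ltW.
by split=> //; apply: root => //; rewrite ge_min lexx ?orbT.
Qed.

(** Reduces the matrix inequality to the scalars of [power_gap]. Since a^p and a^q are at most k^4,
    their effect is absorbed in the k^3 terms and in 4 k^2. *)
Lemma trace_gap (R : realType) (alpha p q k a : R) (beta := alpha * (1 - alpha)) :
  0 < alpha -> alpha < 1 -> 0 < p -> 0 < q ->
  0 < k -> k <= 4^-1 -> k <= beta ->
  0 < a -> a `^ p <= k ^+ 4 -> a `^ q <= k ^+ 4 ->
  exists (A B : 'M[R[i]]_2) (sg aq : R),
    [/\ posdefmx A, posdefmx B, \tr (SG alpha p A B) = (sg)%:C%C,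
        \tr (Aq alpha q A B) = (aq)%:C%C &
        (1 - (2 * beta * k ^+ 2 + 3 * k ^+ 3)) `^ p^-1 <= sg /\
        aq <= (1 - (beta * k ^+ 2 - k ^+ 3)) `^ q^-1 + (4 * k ^+ 2) `^ q^-1].
Proof.
move=> al0 al1 p0 q0 k0 k1 kb a0 ep dq.
set e := a `^ p in ep *; set d := a `^ q in dq *.
have e0 : 0 < e by apply: powR_gt0.
have d0 : 0 < d by apply: powR_gt0.
have beta0 : 0 < beta by rewrite mulr_gt0 // subr_gt0.
have beta1 : beta <= 4^-1 by rewrite /beta; have := sqr_ge0 (2 * alpha - 1); lra.
have k20 : 0 < k ^+ 2 by rewrite exprn_gt0.
have k21 : k ^+ 2 <= 4^-1 * k by rewrite expr2 ler_wpM2r // ltW.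
have bk2 : beta * k ^+ 2 <= 4^-1 * k ^+ 2 by rewrite ler_wpM2r // ltW.
have k30 : 0 < k ^+ 3 by rewrite exprn_gt0.
have k31 : k ^+ 3 <= 4^-1 * k ^+ 2 by rewrite exprS ler_wpM2r // ltW.
have k40 : 0 < k ^+ 4 by rewrite exprn_gt0.
have k41 : k ^+ 4 <= 4^-1 * k ^+ 3 by rewrite exprS ler_wpM2r // ltW.
(* With this sine, the equation for m required by [tr_SG] becomes m^2 = (1 + k)/(1 - k), free of a,
   so that [cosh_ratio_ge] applies. *)
pose s := (1 + e) / (1 - e) * k.
have e1 : 0 < 1 - e by lra.
have se : (1 - e) * s = (1 + e) * k by rewrite /s; field; rewrite gt_eqF.
have ks : k <= s.
  by rewrite /s -[leLHS]mul1r ler_wpM2r ?(ltW k0) // ler_pdivlMr // mul1r; lra.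
have s2k : s <= 2 * k.
  by rewrite /s ler_wpM2r ?(ltW k0) // ler_pdivrMr //; lra.
have s1 : s < 1 by lra.
have s0 : 0 < s by lra.
have s21 : s ^+ 2 < 1 by rewrite expr_lt1 // ltW.
pose c := Num.sqrt (1 - s ^+ 2).
have sc1 : c ^+ 2 = 1 - s ^+ 2 by rewrite sqr_sqrtr // subr_ge0 ltW.
pose m := Num.sqrt ((1 + k) / (1 - k)).
have kn : 0 < 1 - k by lra.
have m0 : 0 < m by rewrite sqrtr_gt0 divr_gt0 //; lra.
have m2 : m ^+ 2 = (1 + k) / (1 - k) by rewrite sqr_sqrtr // divr_ge0 //; lra.
pose w := m `^ alpha.
have := @cosh_ratio_ge R alpha k al0 al1 k0 k1.
rewrite -/m -/w -/beta; set phi := (_ / 2) => phi_ge.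
have phi0 : 2^-1 <= phi by lra.
(* T is the trace of F_alpha (A^p, B^p), whose determinant is e. *)
pose T := (1 + e) * phi.
have Tphi : phi <= T by rewrite /T mulrDl mul1r lerDl mulr_ge0 // ?(ltW e0) //; lra.
have [|//|| f1 [f2 [fs fp f20 f21]]] := pos_roots_sum_prod T e.
- by lra.
- by have : 2^-1 * 2^-1 <= T ^+ 2; [rewrite expr2 ler_pM //|]; lra.
(* The excess of the determinant of (1 - alpha) A^q + alpha B^q over d = a^q. *)
pose g := beta * (1 - d) ^+ 2 * s ^+ 2.
have d1 : d < 1 by lra.
have g0 : 0 <= g.
  exact: mulr_ge0 (mulr_ge0 (ltW beta0) (sqr_ge0 _)) (sqr_ge0 _).
have [| || n1 [n2 [ns np n20 n21]]] := pos_roots_sum_prod (1 + d) (d + g).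
- by lra.
- by lra.
- rewrite -subr_ge0.
  have -> : (1 + d) ^+ 2 - 4 * (d + g) = (1 - d) ^+ 2 * (1 - 4 * beta * s ^+ 2).
    by rewrite /g; ring.
  rewrite mulr_ge0 ?sqr_ge0 // subr_ge0.
  have : beta * s ^+ 2 <= 4^-1 * 1.
    by apply: ler_pM; rewrite ?sqr_ge0 // ltW.
  by lra.
exists (specmx 1 0 1 a), (specmx (1 - s ^+ 2) (c * s) 1 a).
exists (f1 `^ p^-1 + f2 `^ p^-1), (n1 `^ q^-1 + n2 `^ q^-1); split.
- by apply: specmx_posdef => //; [ring|rewrite ler01 lexx].
- apply: specmx_posdef => //; first exact: rotation_offdiag_sq.
  by apply/andP; split; have := sqr_ge0 s; lra.
- apply: (@tr_SG _ _ _ _ _ _ m) => //; rewrite -/e ?fp //.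
  + exact: ltW.
  + by rewrite se m2; field; rewrite gt_eqF.
  + by rewrite fs /T /phi -/w se; field; rewrite gt_eqF // powR_gt0.
- by apply: tr_Aq; rewrite ?ns ?np // /g /beta.
split.
(* f1 >= phi - 4e, and 4e <= 4 k^4 <= k^3 raises the cubic coefficient from 2 to 3. The power of f2
   is then dropped as nonnegative. *)
- have f1_ge : 1 - (2 * beta * k ^+ 2 + 3 * k ^+ 3) <= f1.
    have := @dominant_root_ge R T e f1 f2 _ fs fp f20 f21; lra.
  apply: ler_wpDr; first exact: powR_ge0.
  apply: ge0_ler_powR; rewrite ?nnegrE ?invr_ge0 ?(ltW p0) //.
  + by lra.
  + by lra.
have [n1_le n2_le] := @root_bounds R d g n1 n2 d0 d1 g0 ns np n20 n21.
have g_ge : beta * k ^+ 2 - k ^+ 3 <= g.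
  have h : (1 - 2 * k ^+ 4) * k ^+ 2 <= (1 - d) ^+ 2 * s ^+ 2.
    apply: ler_pM; first by lra.
    - exact: ltW.
    - by have := sqr_ge0 d; lra.
    - by rewrite ler_sqr ?nnegrE // ltW.
  have := ler_wpM2l (ltW beta0) h; rewrite [leRHS]mulrA -/g.
  have : beta * k ^+ 2 * k ^+ 4 <= 4^-1 * k ^+ 4 by rewrite ler_wpM2r ?(ltW k40) //; lra.
  lra.
have g_le : g <= k ^+ 2.
  have h : (1 - d) ^+ 2 * s ^+ 2 <= 1 * (2 * k) ^+ 2.
    apply: ler_pM; rewrite ?sqr_ge0 //.
    - by rewrite expr_le1 //; lra.
    - by rewrite ler_sqr ?nnegrE //; lra.
  rewrite /g -mulrA; apply: le_trans (ler_pM (ltW beta0) _ beta1 h) _.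
    by rewrite mulr_ge0 ?sqr_ge0.
  by lra.
apply: lerD; apply: ge0_ler_powR; rewrite ?nnegrE ?invr_ge0 ?(ltW q0) //.
- by lra.
- by lra.
- by lra.
- by lra.
- by lra.
- by lra.
Qed.

Theorem theorem4p29 (R : realType) (alpha p q : R) :
  0 < alpha -> alpha < 1 -> 0 < p -> 0 < q ->
  (forall A B : 'M[R[i]]_2, posdefmx A -> posdefmx B ->
     \tr (SG alpha p A B) <= \tr (Aq alpha q A B)) ->
  Num.min 1 (p / 2) <= q.
Proof.
move=> al0 al1 p0 q0 trace_le; rewrite leNgt; apply/negP.
(* The negation yields 1/q > 1 and 2/p < 1/q, exactly what [power_gap] asks. *)
rewrite lt_min => /andP[q1 qp].
have beta0 : 0 < alpha * (1 - alpha) by rewrite mulr_gt0 // subr_gt0.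
have beta1 : alpha * (1 - alpha) <= 4^-1.
  by have := sqr_ge0 (2 * alpha - 1); lra.
have [||| k [k0 k1 kb gap]] := @power_gap R _ p^-1 q^-1 beta0 beta1.
- by rewrite invr_gt0.
- by rewrite invf_gt1.
- by rewrite ltr_pdivrMr // mulrC ltr_pdivlMr //; lra.
have [a [a0 ap aq]] := powR_le_both R p q (k ^+ 4) p0 q0 (exprn_gt0 4 k0).
have [A [B [sg [aq' [pA pB trSG trAq [lo hi]]]]]] :=
  trace_gap R alpha p q k a al0 al1 p0 q0 k0 k1 kb a0 ap aq.
have := trace_le A B pA pB; rewrite trSG trAq lecR => h.
by have := lt_le_trans gap (le_trans lo (le_trans h hi)); rewrite ltxx.
Qed.
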